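(* Let $(B,Y)$ be a quantum $Y$-seed with $B=(b_{ij})_{i,j=1}^n$ and $Y=(Y_1,\dots,Y_n)$, with associated data $\mathbf{d}=(d_1,\dots,d_n)$, $\mathbf{r}=(r_1,\dots,r_n)$, $\mathbf{z}=(z_{i,s})$. For all $i,k\in\{1,\dots,n\}$ and each sign $\varepsilon\in\{+1,-1\}$, $$\mathrm{Ad}\bigl(\Psi_{d_k,\mathbf{z}_k,q_k}(Y_k^{\varepsilon})\bigr)^{\varepsilon}(Y_i)=Y_i\prod_{m=1}^{|b_{ki}|}\left(\sum_{s=0}^{d_k} z_{k,s}\,q_k^{-\varepsilon\,\mathrm{sgn}(b_{ki})(2m-1)s}\,Y_k^{\varepsilon s}\right)^{-\mathrm{sgn}(b_{ki})}.$$
   Context: Data. $B=(b_{ij})_{i,j=1}^n$ is a skew-symmetrizable integer matrix; $\mathbf{d}=(d_1,\dots,d_n)$ is an $n$-tuple of positive integers; $\mathbf{r}=(r_1,\dots,r_n)$ is an $n$-tuple of positive integers with $r_id_ib_{ij}=-r_jd_jb_{ji}$ for all $i,j$. $q$ is a formal variable and $q_i:=q^{r_id_i}$. $F$ is a field, and $\mathbf{z}=(z_{i,s})_{i=1,\dots,n;\,s=1,\dots,d_i-1}$ is a collection of elements of $F$ satisfying the reciprocity condition $z_{i,s}=z_{i,d_i-s}$; one sets $z_{i,0}=z_{i,d_i}=1$ and $\mathbf{z}_i=(z_{i,s})_{s=1,\dots,d_i-1}$. Quantum $Y$-seed. $Y=(Y_1,\dots,Y_n)$ is an $n$-tuple of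 noncommuting (invertible) formal variables with commutation relations $Y_iY_j=q^{2r_jd_jb_{ji}}Y_jY_i$; $q$ and the elements of $F$ commute with all $Y_i$. The pair $(B,Y)$ is called a quantum $Y$-seed. Quantum dilogarithm. For a field $F$, a positive integer $d$ and $\mathbf{w}=(w_1,\dots,w_{d-1})\in F^{d-1}$ (empty if $d=1$), with $w_0=w_d=1$, $$\Psi_{d,\mathbf{w},q}(x)=\prod_{m=0}^{\infty}\left(\sum_{s=0}^{d}w_sq^{s(2m+1)}x^s\right)^{-1},$$ a formal power series in $x$ with coefficients in the rational function field $F(q)$ (the product being understood by expanding in $q$). $\Psi_{d_k,\mathbf{z}_k,q_k}$ is obtained by taking $d=d_k$, $\mathbf{w}=\mathbf{z}_k$ and replacing $q$ by $q_k$. Adjoint action. $$\mathrm{Ad}\bigl(\Psi_{d_k,\mathbf{z}_k,q_k}(Y_k^{\varepsilon})\bigr)^{\varepsilon}(Y_i):=\Psi_{d_k,\mathbf{z}_k,q_k}(Y_k^{\varepsilon})^{\varepsilon}\,Y_i\,\Psi_{d_k,\mathbf{z}_k,q_k}(Y_k^{\varepsilon})^{-\varepsilon}.$$ Computations take place in the ring of formal Laurent series in $Y_k^{\varepsilon}$ (finitely many negative powers of $Y_k^{\varepsilon}$) with coefficients in the $F(q)$-algebra generated by the $Y_j^{\pm1}$, $j\ne k$, with multiplication determined by the commutation relations; inverses of series with constant term $1$ are expanded in powers of $Y_k^{\varepsilon}$. For an integer $a$, $\mathrm{sgn}(a)=+1,0,-1$ according to $a>0$, $a=0$, $a<0$.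 Empty products equal $1$. *)

(* Defs.v *)
From HB Require Import structures.
From mathcomp Require Import all_boot all_order all_algebra.
From mathcomp Require Import all_classical.
Set Implicit Arguments.
Unset Strict Implicit.
Unset Printing Implicit Defensive.
Import Order.TTheory GRing.Theory Num.Theory.
Local Open Scope classical_set_scope.
Local Open Scope ring_scope.

Notation "x %:F" := (FracField.tofrac x) : ring_scope.

(** * The coefficient field F(q) and q-adic limits *)

Notation ratfun F := {fraction {poly F}}.

Section RatFun.
Variable F : fieldType.

Definition qvar : ratfun F := ('X : {poly F})%:F.

Definition ratconst (c : F) : ratfun F := (c%:P)%:F.

Lemma qvar_neq0 : qvar != 0.
Proof. by rewrite /qvar tofrac_eq0 polyX_eq0. Qed.

(* x lies in q^N F[q]_(q), i.e. the expansion of x in q starts at degree >= N *)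
Definition qadic_small (N : nat) (x : ratfun F) : Prop :=
  exists p g : {poly F}, g.[0] != 0 /\ x = ('X^N * p)%:F / g%:F.

Definition qadic_cvg (u : nat -> ratfun F) (l : ratfun F) : Prop :=
  forall N, exists M0, forall M, (M0 <= M)%N -> qadic_small N (u M - l).

(* a junk value if u has no q-adic limit in F(q) *)
Definition qadic_lim (u : nat -> ratfun F) : ratfun F :=
  xget 0 [set l | qadic_cvg u l].

Lemma qadic_smallB N x y :
  qadic_small N x -> qadic_small N y -> qadic_small N (x - y).
Proof.
move=> [p [g [g0 ->]]] [p' [g' [g'0 ->]]].
exists (p * g' - p' * g), (g * g'); split; first by rewrite hornerM mulf_neq0.
have nz (h : {poly F}) : h.[0] != 0 -> h%:F != 0.
  by rewrite tofrac_eq0; apply: contra_neq => ->; rewrite horner0.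
rewrite -mulNr addf_div ?nz // -tofracN -!tofracM -tofracD; congr (_%:F / _).
by rewrite mulrBr !mulrA mulNr.
Qed.

Lemma qadic_small0 x : (forall N, qadic_small N x) -> x = 0.
Proof.
move=> xs; have [p [g [g0 xE]]] := xs 0%N.
have nz (h : {poly F}) : h.[0] != 0 -> h%:F != 0.
  by rewrite tofrac_eq0; apply: contra_neq => ->; rewrite horner0.
case: (eqVneq p 0) => [p0|p0]; first by rewrite xE p0 mulr0 rmorph0 mul0r.
have [p' [g' [g'0 xE']]] := xs (size p).
move/eqP: xE'; rewrite xE expr0 mul1r eqr_div ?nz // -!tofracM tofrac_eq.
move=> /eqP E; have /eqP := p0; case; apply/eqP.
have : 'X^(size p) %| p * g' by rewrite E -mulrA dvdp_mulr.
rewrite Gauss_dvdpl; last first.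
  by apply: coprimep_expl; rewrite -['X]subr0 coprimep_sym coprimep_XsubC.
by move/dvdp_leq => /(_ p0); rewrite size_polyXn ltnn.
Qed.

Lemma qadic_limE u l : qadic_cvg u l -> qadic_lim u = l.
Proof.
move=> ul; apply: xget_unique => // l' ul'.
apply/eqP; rewrite -subr_eq0; apply/eqP/qadic_small0 => N.
have [M1 H1] := ul N; have [M2 H2] := ul' N.
rewrite (_ : l' - l = (u (maxn M1 M2) - l) - (u (maxn M1 M2) - l')).
  by apply: qadic_smallB; [apply: H1|apply: H2]; rewrite ?leq_maxl ?leq_maxr.
by rewrite opprB [RHS]addrC addrA subrK.
Qed.

End RatFun.

(** * Formal power series *)

Record fps (R : Type) := FPS { fpsc : nat -> R }.

HB.instance Definition _ (R : Type) := gen_eqMixin (fps R).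
HB.instance Definition _ (R : Type) := gen_choiceMixin (fps R).

Section FPS.
Variable R : comNzRingType.
Implicit Types f g h : fps R.

Lemma fpsP f g : fpsc f =1 fpsc g -> f = g.
Proof. by case: f g => [f] [g] /= /funext ->. Qed.

Definition fps_zero : fps R := FPS (fun _ => 0).
Definition fps_opp f : fps R := FPS (fun j => - fpsc f j).
Definition fps_add f g : fps R := FPS (fun j => fpsc f j + fpsc g j).
Definition fps_of_poly (p : {poly R}) : fps R := FPS (fun j => p`_j).
Definition fps_mul f g : fps R :=
  FPS (fun j => \sum_(i < j.+1) fpsc f i * fpsc g (j - i)%N).

Fact fps_addA : associative fps_add.
Proof. by move=> f g h; apply: fpsP => j /=; rewrite addrA. Qed.
Fact fps_addC : commutative fps_add.
Proof. by move=> f g; apply: fpsP => j /=; rewrite addrC. Qed.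
Fact fps_add0 : left_id fps_zero fps_add.
Proof. by move=> f; apply: fpsP => j /=; rewrite add0r. Qed.
Fact fps_addN : left_inverse fps_zero fps_opp fps_add.
Proof. by move=> f; apply: fpsP => j /=; rewrite addNr. Qed.

HB.instance Definition _ :=
  GRing.isZmodule.Build (fps R) fps_addA fps_addC fps_add0 fps_addN.

Let trunc N f : {poly R} := \poly_(i < N) fpsc f i.

Let coef_truncM N f g j : (j < N)%N ->
  (trunc N f * trunc N g)`_j = fpsc (fps_mul f g) j.
Proof.
move=> jN; rewrite coefM; apply: eq_bigr => i _; rewrite !coef_poly.
by rewrite (leq_ltn_trans (leq_subr _ _) jN) (leq_ltn_trans _ jN) // -ltnS.
Qed.

Fact fps_mulC : commutative fps_mul.
Proof. by move=> f g; apply: fpsP => j; rewrite -!(coef_truncM _ _ (ltnSn j)) mulrC. Qed.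

Fact fps_mulA : associative fps_mul.
Proof.
move=> f g h; apply: fpsP => j /=; have jN := ltnSn j.
transitivity ((trunc j.+1 f * (trunc j.+1 g * trunc j.+1 h))`_j).
  rewrite coefM; apply: eq_bigr => i _.
  by rewrite coef_truncM ?ltnS ?leq_subr // coef_poly ltn_ord.
rewrite mulrA coefM; apply: eq_bigr => i _.
by rewrite coef_truncM // coef_poly ltnS leq_subr.
Qed.

Fact fps_mul1 : left_id (fps_of_poly 1) fps_mul.
Proof.
move=> f; apply: fpsP => j /=; rewrite big_ord_recl /= coef1 mul1r subn0.
by rewrite big1 ?addr0 // => i _; rewrite coef1 mul0r.
Qed.

Fact fps_mulDl : left_distributive fps_mul fps_add.
Proof.
move=> f g h; apply: fpsP => j /=; rewrite -big_split /=.
by apply: eq_bigr => i _; rewrite mulrDl.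
Qed.

Fact fps_1_neq0 : fps_of_poly 1 != fps_zero.
Proof.
apply/eqP => /(congr1 (fun f => fpsc f 0)) /= /eqP.
by rewrite coef1 eqxx oner_eq0.
Qed.

HB.instance Definition _ := GRing.Zmodule_isComNzRing.Build (fps R)
  fps_mulA fps_mulC fps_mul1 fps_mulDl fps_1_neq0.

Definition fps_unit : {pred fps R} := fun f => `[< exists g, g * f = 1 >].
Definition fps_inv f : fps R := xget f [set g | g * f = 1].

Fact fps_mulVx : {in fps_unit, left_inverse 1 fps_inv *%R}.
Proof. by move=> f /asboolP; apply: xgetPex. Qed.
Fact fps_unitPl f g : g * f = 1 -> fps_unit f.
Proof. by move=> gf; apply/asboolP; exists g. Qed.
Fact fps_invr_out : {in [predC fps_unit], fps_inv =1 id}.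
Proof.
move=> f; rewrite inE => /negP nf; rewrite /fps_inv.
by case: xgetP => // g _ gf; case: nf; apply/asboolP; exists g.
Qed.

HB.instance Definition _ := GRing.ComNzRing_hasMulInverse.Build (fps R)
  fps_mulVx fps_unitPl fps_invr_out.

End FPS.

(** * The quantum dilogarithm *)

(* w_0 = w_d = 1; only the values w_s with 0 < s < d are used *)
Definition with_ends (F : fieldType) (d : nat) (w : nat -> F) (s : nat) : F :=
  if (s == 0)%N || (s == d) then 1 else w s.

(* t is a positive power of q; the infinite product is the coefficientwise
   q-adic limit of its partial products in F(q)[[x]] *)
Definition qdilog (F : fieldType) (d : nat) (w : nat -> F) (t : ratfun F) :
    fps (ratfun F) :=
  FPS (fun j => qadic_lim (fun M => fpsc (\prod_(m < M)
    (fps_of_poly (\poly_(s < d.+1)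
       (ratconst (with_ends d w s) * t ^+ (s * (2 * m + 1)))))^-1) j)).

(** * Twisted convolution on a graded group *)

Section Convolution.
Variables (K : fieldType) (G : zmodType) (deg : {additive G -> int}).
Variable chi : G -> G -> K.
Hypothesis chiDl : forall a b c, chi (a + b) c = chi a c * chi b c.
Hypothesis chiDr : forall a b c, chi a (b + c) = chi a b * chi a c.
Hypothesis chi0l : forall a, chi 0 a = 1.
Hypothesis chi0r : forall a, chi a 0 = 1.
Implicit Types f g h : G -> K.

(* finitely many negative degrees, finitely many terms in each degree *)
Definition laurent_supp f : Prop :=
  (exists N : int, forall a, f a != 0 -> N <= deg a) /\
  (forall m : int, finite_set [set a | deg a = m /\ f a != 0]).

Definition conv f g (c : G) : K :=
  \sum_(a \in [set: G]) f a * g (c - a) * chi a (c - a).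

Lemma laurent_supp_le f : laurent_supp f ->
  forall M : int, finite_set [set a | deg a <= M /\ f a != 0].
Proof.
move=> [[N fN] ff] M.
apply: (@sub_finite_set _ _ (\bigcup_(i in `I_(`|M - N|.+1))
   [set a | deg a = N + i%:Z /\ f a != 0])); last first.
  by apply: bigcup_finite => [|i _]; [exact: finite_II | exact: ff].
move=> a /= [aM fa]; have Na := fN _ fa.
exists `|deg a - N|%N => /=; last first.
  by split=> //; rewrite gez0_abs ?subr_ge0 // [RHS]addrC subrK.
by rewrite ltnS -lez_nat !gez0_abs ?subr_ge0 ?(le_trans Na) // lerD2r.
Qed.

Lemma conv_supp f g c : laurent_supp f -> laurent_supp g ->
  finite_set [set a | f a * g (c - a) * chi a (c - a) != 0].
Proof.
move=> sf [[N gN] _].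
apply: sub_finite_set (laurent_supp_le sf (deg c - N)) => a /=.
rewrite !mulf_eq0 !negb_or => /andP[/andP[fa ga] _]; split=> //.
by have := gN _ ga; rewrite raddfB lerBrDr addrC -lerBrDr.
Qed.

Lemma convE f g c (A : set G) :
  (forall a, f a != 0 -> g (c - a) != 0 -> A a) ->
  conv f g c = \sum_(a \in A) f a * g (c - a) * chi a (c - a).
Proof.
move=> H; apply/esym/fsbig_widen => // a [_ nAa] /=.
apply/eqP; rewrite !mulf_eq0; apply/negPn/negP; rewrite !negb_or.
by move=> /andP[/andP[fa ga] _]; apply/nAa/H.
Qed.

Lemma conv_neq0 f g c : conv f g c != 0 ->
  exists2 a, f a != 0 & g (c - a) != 0.
Proof.
move=> nz; apply: contrapT => H; move/eqP: nz; apply; apply: fsbig1 => a _.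
apply/eqP; rewrite !mulf_eq0; apply/negPn/negP; rewrite !negb_or.
by move=> /andP[/andP[fa ga] _]; apply: H; exists a.
Qed.

Lemma laurent_supp_conv f g :
  laurent_supp f -> laurent_supp g -> laurent_supp (conv f g).
Proof.
move=> sf sg; have [[N fN] _] := sf; have [[N' gN] _] := sg.
split.
  exists (N + N') => c /conv_neq0[a fa ga].
  by rewrite -[c](subrK a) raddfD addrC lerD ?gN ?fN.
move=> m; apply: (@sub_finite_set _ _
    [set a + b | a in [set a | deg a <= m - N' /\ f a != 0]
               & b in [set b | deg b <= m - N /\ g b != 0]]); last first.
  by apply: finite_image2; apply: laurent_supp_le.
move=> c /= [cm /conv_neq0[a fa ga]].
have := fN _ fa; have := gN _ ga; rewrite raddfB cm => Ha Hb.
exists a; first by split=> //; rewrite lerBrDr addrC -lerBrDr.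
by exists (c - a); rewrite /= ?raddfB ?cm; [rewrite lerD2l lerN2 | rewrite addrC subrK].
Qed.

Lemma laurent_suppD f g : laurent_supp f -> laurent_supp g ->
  laurent_supp (fun a => f a + g a).
Proof.
move=> [[N fN] ff] [[N' gN] gf].
have nz a : f a + g a != 0 -> f a != 0 \/ g a != 0.
  by case: (eqVneq (f a) 0) => [->|]; [rewrite add0r; right | left].
split.
  exists (Num.min N N') => a /nz; rewrite ge_min.
  by case=> [/fN->|/gN->]; rewrite ?orbT.
move=> m; apply: sub_finite_set (_ : finite_set
  ([set a | deg a = m /\ f a != 0] `|` [set a | deg a = m /\ g a != 0])).
  by move=> a /= [am /nz[]]; [left|right].
by rewrite finite_setU.
Qed.

Lemma laurent_suppS f g : (forall a, g a != 0 -> f a != 0) ->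
  laurent_supp f -> laurent_supp g.
Proof.
move=> H [[N fN] ff]; split; first by exists N => a /H /fN.
by move=> m; apply: sub_finite_set (ff m) => a /= [am /H].
Qed.

Lemma convA f g h : laurent_supp f -> laurent_supp g -> laurent_supp h ->
  conv f (conv g h) =1 conv (conv f g) h.
Proof.
move=> sf sg sh c.
have [[nf fN] _] := sf; have [[ng gN] _] := sg; have [[nh hN] _] := sh.
pose A := [set a | deg a <= deg c - nh - ng /\ f a != 0].
pose B := [set a + b | a in A
            & b in [set b | deg b <= deg c - nh - nf /\ g b != 0]].
have finA : finite_set A by apply: laurent_supp_le.
have finB : finite_set B.
  by apply: finite_image2 => //; apply: laurent_supp_le.
have inAB a b : f a != 0 -> g (b - a) != 0 -> h (c - b) != 0 -> A a /\ B b.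
  move=> fa ga hb; have := fN _ fa; have := gN _ ga; have := hN _ hb.
  rewrite !raddfB => h1 h2 h3.
  have bc : deg b <= deg c - nh by rewrite lerBrDr addrC -lerBrDr.
  have Aa : A a.
    split=> //; rewrite lerBrDr addrC -lerBrDr.
    by apply: le_trans h2 _; rewrite lerD2r.
  split=> //; exists a => //; exists (b - a); last by rewrite addrC subrK.
  by split=> //; rewrite raddfB; apply: lerD => //; rewrite lerN2.
pose T a b := f a * g (b - a) * h (c - b) * chi a (b - a)
                * chi a (c - b) * chi (b - a) (c - b).
transitivity (\sum_(a \in A) \sum_(b \in B) T a b).
  rewrite (@convE _ _ _ A); last first.
    move=> a fa /conv_neq0[b' gb' hb'].
    by have [] // := @inAB a (b' + a) fa; rewrite ?addrK // opprD addrA addrAC.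
  apply: eq_fsbigr => a /set_mem Aa.
  rewrite /conv (@reindex_fsbigT _ _ _ _ _ (fun b => b - a)); last first.
    by exists (fun b => b + a) => b; rewrite ?subrK ?addrK.
  have E b : c - a - (b - a) = c - b by rewrite opprB addrA subrK.
  transitivity (f a * (\sum_(b \in B) g (b - a) * h (c - b) * chi (b - a) (c - b))
     * chi a (c - a)).
    congr (_ * _ * _); apply/esym.
    rewrite (fsbig_widen B [set: G]) //; last first.
      move=> b [_ nBb] /=; apply/eqP; rewrite !mulf_eq0; apply/negPn/negP.
      rewrite !negb_or => /andP[/andP[gb hb] _]; apply: nBb.
      by have [] := @inAB a b (proj2 Aa) gb hb.
    by apply: eq_fsbigr => b _; rewrite E.
  rewrite mulr_fsumr mulr_fsuml; apply: eq_fsbigr => b _; rewrite /T.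
  have -> : c - a = (b - a) + (c - b) by rewrite [RHS]addrC addrA subrK.
  by rewrite (chiDr a (b - a)) !mulrA 2!(mulrAC _ (chi (b - a) (c - b)) _).
rewrite exchange_fsbig // (@convE _ _ _ B); last first.
  move=> b /conv_neq0[a fa gb] hb.
  by have [] := inAB a b fa gb hb.
apply: eq_fsbigr => b _.
have [hb|hb] := eqVneq (h (c - b)) 0.
  rewrite hb mulr0 mul0r; apply: fsbig1 => a _.
  by rewrite /T hb mulr0 !mul0r.
rewrite (@convE _ _ _ A); last first.
  by move=> a fa gb; have [] := inAB a b fa gb hb.
rewrite !mulr_fsuml; apply: eq_fsbigr => a _; rewrite /T.
have := chiDl (b - a) a (c - b); rewrite subrK => ->.
by rewrite !mulrA (mulrAC _ (chi a (b - a)) (h _)) (mulrAC _ (chi a _) (chi _ _)).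
Qed.

Definition monom (a : G) : G -> K := fun c => (c == a)%:R.

Lemma laurent_supp_monom a : laurent_supp (monom a).
Proof.
have nz c : monom a c != 0 -> c = a.
  by rewrite /monom; case: (eqVneq c a) => // _; rewrite eqxx.
split; first by exists (deg a) => c /nz ->.
by move=> m; apply: sub_finite_set (finite_set1 a) => c /= [_ /nz].
Qed.

Lemma conv_monoml a f c : conv (monom a) f c = f (c - a) * chi a (c - a).
Proof.
rewrite (@convE _ _ _ [set a]); last first.
  by rewrite /monom => b; case: (eqVneq b a) => [-> //|_]; rewrite eqxx.
by rewrite fsbig_set1 /monom eqxx mul1r.
Qed.

Lemma conv_monomr a f c : conv f (monom a) c = f (c - a) * chi (c - a) a.
Proof.
rewrite (@convE _ _ _ [set c - a]); last first.
  rewrite /monom => b _; case: (eqVneq (c - b) a) => [<- _ /=|_]; last by rewrite eqxx.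
  by rewrite opprB addrC subrK.
have E : c - (c - a) = a by rewrite opprB addrC subrK.
by rewrite fsbig_set1 E /monom eqxx mulr1.
Qed.

Lemma conv1f f : conv (monom 0) f =1 f.
Proof. by move=> c; rewrite conv_monoml subr0 chi0l mulr1. Qed.

Lemma convf1 f : conv f (monom 0) =1 f.
Proof. by move=> c; rewrite conv_monomr subr0 chi0r mulr1. Qed.

Lemma conv_add_finite f g h c :
  laurent_supp f -> laurent_supp g -> laurent_supp h ->
  exists2 A : set G, finite_set A
    & forall a, f a != 0 \/ g a != 0 -> h (c - a) != 0 -> A a.
Proof.
move=> sf sg [[N hN] _].
exists ([set a | deg a <= deg c - N /\ f a != 0] `|`
        [set a | deg a <= deg c - N /\ g a != 0]).
  by rewrite finite_setU; split; apply: laurent_supp_le.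
move=> a fga /hN; rewrite raddfB lerBrDr addrC -lerBrDr => da.
by case: fga; [left|right].
Qed.

Lemma convDl f g h : laurent_supp f -> laurent_supp g -> laurent_supp h ->
  conv (fun a => f a + g a) h =1 (fun a => conv f h a + conv g h a).
Proof.
move=> sf sg sh c; have [A finA HA] := conv_add_finite c sf sg sh.
rewrite !(@convE _ h c A); last 3 first.
- by move=> a ga; apply: HA; right.
- by move=> a fa; apply: HA; left.
- move=> a fga; apply: HA.
  by case: (eqVneq (f a) 0) fga => [->|]; [rewrite add0r; right|left].
rewrite -fsbig_split //=; apply: eq_fsbigr => a _.
by rewrite !mulrDl.
Qed.

Lemma convDr f g h : laurent_supp f -> laurent_supp g -> laurent_supp h ->
  conv h (fun a => f a + g a) =1 (fun a => conv h f a + conv h g a).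
Proof.
move=> sf sg sh c.
pose A := [set a | h a * f (c - a) * chi a (c - a) != 0 \/
                   h a * g (c - a) * chi a (c - a) != 0].
have finA : finite_set A.
  apply: (@sub_finite_set _ _
    ([set a | h a * f (c - a) * chi a (c - a) != 0] `|`
     [set a | h a * g (c - a) * chi a (c - a) != 0])) => //.
  by rewrite finite_setU; split; apply: conv_supp.
have widen (u : G -> K) : (forall a, u a != 0 -> A a) ->
    \sum_(a \in [set: G]) u a = \sum_(a \in A) u a.
  move=> uA; rewrite (fsbig_widen A [set: G] u) // => a [_ nA] /=.
  by apply: contrapT => /eqP /uA.
rewrite /conv !widen; last 3 first.
- by move=> a; right.
- by move=> a; left.
- move=> a; rewrite mulrDr mulrDl => nz.
  rewrite /A /=; case: (eqVneq (h a * f (c - a) * chi a (c - a)) 0) nz.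
    by move=> ->; rewrite add0r; right.
  by left.
rewrite -fsbig_split //=; apply: eq_fsbigr => a _.
by rewrite mulrDr mulrDl.
Qed.

Lemma convZl k f g : conv (fun a => k * f a) g =1 (fun a => k * conv f g a).
Proof.
by move=> c; rewrite mulr_fsumr; apply: eq_fsbigr => a _; rewrite !mulrA.
Qed.

Lemma convZr k f g : conv f (fun a => k * g a) =1 (fun a => k * conv f g a).
Proof.
move=> c; rewrite mulr_fsumr; apply: eq_fsbigr => a _.
by rewrite !mulrA (mulrC (f a)).
Qed.

End Convolution.

(** * Laurent series in Y_k^e over the quantum torus *)

Variant sign := Plus | Minus.

Coercion int_of_sign (e : sign) : int := if e is Plus then 1 else -1.

Section QuantumLaurent.
Variable F : fieldType.
Local Notation K := (ratfun F).
Variable n : nat.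

Definition ydeg (k : 'I_n) (e : sign) (a : 'rV[int]_n) : int := (e : int) * a 0 k.

Fact ydeg_is_zmod_morphism k e : zmod_morphism (ydeg k e).
Proof. by move=> a b; rewrite /ydeg !mxE mulrBr. Qed.
HB.instance Definition _ k e :=
  GRing.isZmodMorphism.Build _ _ (ydeg k e) (@ydeg_is_zmod_morphism k e).

(* Monomials are Weyl ordered: for a skew-symmetric integer matrix L,
     Y^a = q^(- sum_(i<j) L_ij a_i a_j) Y_1^(a_1) ... Y_n^(a_n),
   so that Y_i Y_j = q^(2 L_ij) Y_j Y_i amounts to
     Y^a Y^b = q^(lform L a b) Y^(a + b). *)
Definition lform (L : 'M[int]_n) (a b : 'rV[int]_n) : int :=
  \sum_i \sum_j a 0 i * L i j * b 0 j.

Definition ytwist (L : 'M[int]_n) (a b : 'rV[int]_n) : K :=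
  @qvar F ^ lform L a b.

Fact ytwistDl L a b c : ytwist L (a + b) c = ytwist L a c * ytwist L b c.
Proof.
rewrite /ytwist -expfzDr ?qvar_neq0 //; congr (_ ^ _); rewrite /lform -big_split.
apply: eq_bigr => i _; rewrite -big_split; apply: eq_bigr => j _.
by rewrite !mxE !mulrDl.
Qed.

Fact ytwistDr L a b c : ytwist L a (b + c) = ytwist L a b * ytwist L a c.
Proof.
rewrite /ytwist -expfzDr ?qvar_neq0 //; congr (_ ^ _); rewrite /lform -big_split.
apply: eq_bigr => i _; rewrite -big_split; apply: eq_bigr => j _.
by rewrite !mxE !mulrDr.
Qed.

Fact ytwist0l L a : ytwist L 0 a = 1.
Proof.
rewrite /ytwist /lform big1 ?expr0z // => i _.
by rewrite big1 // => j _; rewrite mxE !mul0r.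
Qed.

Fact ytwist0r L a : ytwist L a 0 = 1.
Proof.
rewrite /ytwist /lform big1 ?expr0z // => i _.
by rewrite big1 // => j _; rewrite mxE !mulr0.
Qed.

(* x stands for sum_a (qlc x a) Y^a. Since ydeg k e a = e a_k, this is a Laurent
   series in Y_k^e, finite on the negative side, whose coefficients are Laurent
   polynomials in the Y_j with j <> k. *)
Record qlaurent (L : 'M[int]_n) (k : 'I_n) (e : sign) := QLaurent {
  qlc : 'rV[int]_n -> K;
  qlc_supp : laurent_supp (ydeg k e) qlc
}.

HB.instance Definition _ L k e := gen_eqMixin (qlaurent L k e).
HB.instance Definition _ L k e := gen_choiceMixin (qlaurent L k e).

Section Ring.
Variables (L : 'M[int]_n) (k : 'I_n) (e : sign).
Local Notation A := (qlaurent L k e).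
Local Notation deg := (ydeg k e).
Implicit Types x y z : A.

Lemma qlP x y : qlc x =1 qlc y -> x = y.
Proof.
case: x y => [f sf] [g sg] /= /funext fg; rewrite fg in sf *.
by congr QLaurent; exact: Prop_irrelevance.
Qed.

Lemma laurent_supp0 : laurent_supp deg (fun=> 0 : K).
Proof.
apply: laurent_suppS (laurent_supp_monom K deg 0) => a.
by rewrite eqxx.
Qed.

Lemma laurent_suppZ (c : K) (f : 'rV[int]_n -> K) :
  laurent_supp deg f -> laurent_supp deg (fun a => c * f a).
Proof. by apply: laurent_suppS => a; apply: contra_neq => ->; rewrite mulr0. Qed.

Lemma laurent_suppN (f : 'rV[int]_n -> K) :
  laurent_supp deg f -> laurent_supp deg (fun a => - f a).
Proof. by apply: laurent_suppS => a; rewrite oppr_eq0. Qed.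

Definition ql_monom (a : 'rV[int]_n) : A :=
  QLaurent L (laurent_supp_monom K deg a).
Definition ql_zero : A := QLaurent L laurent_supp0.
Definition ql_opp x : A := QLaurent L (laurent_suppN (qlc_supp x)).
Definition ql_add x y : A :=
  QLaurent L (laurent_suppD (qlc_supp x) (qlc_supp y)).
Definition ql_scale (c : K) x : A :=
  QLaurent L (laurent_suppZ c (qlc_supp x)).
Definition ql_mul x y : A :=
  QLaurent L (laurent_supp_conv (ytwist L) (qlc_supp x) (qlc_supp y)).

Fact ql_addA : associative ql_add.
Proof. by move=> x y z; apply: qlP => a /=; rewrite addrA. Qed.
Fact ql_addC : commutative ql_add.
Proof. by move=> x y; apply: qlP => a /=; rewrite addrC. Qed.
Fact ql_add0 : left_id ql_zero ql_add.
Proof. by move=> x; apply: qlP => a /=; rewrite add0r. Qed.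
Fact ql_addN : left_inverse ql_zero ql_opp ql_add.
Proof. by move=> x; apply: qlP => a /=; rewrite addNr. Qed.
Fact ql_mulA : associative ql_mul.
Proof.
move=> x y z; apply: qlP => a /=.
apply: (convA (@ytwistDl L) (@ytwistDr L)); exact: qlc_supp.
Qed.
Fact ql_mul1l : left_id (ql_monom 0) ql_mul.
Proof. by move=> x; apply: qlP => a /=; rewrite conv1f //; apply: ytwist0l. Qed.
Fact ql_mul1r : right_id (ql_monom 0) ql_mul.
Proof. by move=> x; apply: qlP => a /=; rewrite convf1 //; apply: ytwist0r. Qed.
Fact ql_mulDl : left_distributive ql_mul ql_add.
Proof.
move=> x y z; apply: qlP => a /=.
by apply: (convDl (deg := deg)); apply: qlc_supp.
Qed.
Fact ql_mulDr : right_distributive ql_mul ql_add.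
Proof.
move=> x y z; apply: qlP => a /=.
by apply: (convDr (deg := deg)); apply: qlc_supp.
Qed.
Fact ql_1_neq0 : ql_monom 0 != ql_zero.
Proof.
apply/eqP => /(congr1 (fun x => qlc x 0)) /= /eqP.
by rewrite /monom eqxx oner_eq0.
Qed.

HB.instance Definition _ := GRing.isNzRing.Build A
  ql_addA ql_addC ql_add0 ql_addN ql_mulA ql_mul1l ql_mul1r
  ql_mulDl ql_mulDr ql_1_neq0.

Fact ql_scaleA (c d : K) x : ql_scale c (ql_scale d x) = ql_scale (c * d) x.
Proof. by apply: qlP => a /=; rewrite mulrA. Qed.
Fact ql_scale1 : left_id 1 ql_scale.
Proof. by move=> x; apply: qlP => a /=; rewrite mul1r. Qed.
Fact ql_scaleDr : right_distributive ql_scale +%R.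
Proof. by move=> c x y; apply: qlP => a /=; rewrite mulrDr. Qed.
Fact ql_scaleDl x : {morph ql_scale^~ x : c d / c + d}.
Proof. by move=> c d; apply: qlP => a /=; rewrite mulrDl. Qed.

HB.instance Definition _ := GRing.Zmodule_isLmodule.Build K A
  ql_scaleA ql_scale1 ql_scaleDr ql_scaleDl.

Fact ql_scaleAl (c : K) x y : c *: (x * y) = (c *: x) * y.
Proof. by apply: qlP => a /=; rewrite convZl. Qed.
HB.instance Definition _ := GRing.Lmodule_isLalgebra.Build K A ql_scaleAl.

Fact ql_scaleAr (c : K) x y : c *: (x * y) = x * (c *: y).
Proof. by apply: qlP => a /=; rewrite convZr. Qed.
HB.instance Definition _ := GRing.Lalgebra_isAlgebra.Build K A ql_scaleAr.

(* x^-1 is the two-sided inverse in the ring of Laurent series; for a series in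
   Y_k^e with constant term 1 it is the expansion in powers of Y_k^e *)
Definition ql_unit : pred A := fun x => `[< exists y, y * x = 1 /\ x * y = 1 >].
Definition ql_inv x : A := xget x [set y | y * x = 1 /\ x * y = 1].

Fact ql_mulVr : {in ql_unit, left_inverse 1 ql_inv *%R}.
Proof. by move=> x /asboolP /(xgetPex x) []. Qed.
Fact ql_divrr : {in ql_unit, right_inverse 1 ql_inv *%R}.
Proof. by move=> x /asboolP /(xgetPex x) []. Qed.
Fact ql_unitrP x y : y * x = 1 /\ x * y = 1 -> ql_unit x.
Proof. by move=> yx; apply/asboolP; exists y. Qed.
Fact ql_invr_out : {in [predC ql_unit], ql_inv =1 id}.
Proof.
move=> x; rewrite inE => /negP nx; rewrite /ql_inv.
by case: xgetP => // y _ yx; case: nx; apply/asboolP; exists y.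
Qed.

HB.instance Definition _ := GRing.NzRing_hasMulInverse.Build A
  ql_mulVr ql_divrr ql_unitrP ql_invr_out.

Lemma ql_monomM a b :
  ql_monom a * ql_monom b = ytwist L a b *: ql_monom (a + b).
Proof.
apply: qlP => c /=; rewrite conv_monoml mulrC /monom [a + b]addrC -subr_eq.
by case: (eqVneq (c - a) b) => [->|]; rewrite ?mulr0.
Qed.

Lemma ytwist_neq0 a b : ytwist L a b != 0.
Proof. by rewrite expfz_neq0 ?qvar_neq0. Qed.

Lemma ql_monom0 : ql_monom 0 = 1. Proof. by []. Qed.

Lemma ql_monom_invP a (b := (ytwist L a (- a))^-1 *: ql_monom (- a)) :
  b * ql_monom a = 1 /\ ql_monom a * b = 1.
Proof.
have E : ytwist L (- a) a = ytwist L a (- a).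
  rewrite /ytwist /lform; congr (_ ^ _); apply: eq_bigr => i _.
  by apply: eq_bigr => j _; rewrite !mxE !mulNr mulrN.
rewrite /b -ql_scaleAl -ql_scaleAr !ql_monomM E addNr subrr ql_monom0.
by rewrite scalerA mulVf ?ytwist_neq0 // scale1r.
Qed.

Lemma ql_monom_unit a : ql_monom a \is a GRing.unit.
Proof. by apply/unitrP; eexists; exact: ql_monom_invP. Qed.

Lemma ql_monomV a : (ql_monom a)^-1 = (ytwist L a (- a))^-1 *: ql_monom (- a).
Proof.
apply: (mulrI (ql_monom_unit a)); rewrite mulrV ?ql_monom_unit //.
by have [_ ->] := ql_monom_invP a.
Qed.

(* Y_i *)
Definition ql_Y (i : 'I_n) : A := ql_monom (delta_mx 0 i).

Lemma ql_YX_monom m : exists c : K,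
  (ql_Y k ^ e) ^+ m = c *: ql_monom (((e : int) * m%:Z) *: delta_mx 0 k).
Proof.
have [c0 H0] : exists c : K,
    ql_Y k ^ e = c *: ql_monom ((e : int) *: delta_mx 0 k).
  case: e; first by exists 1; rewrite !scale1r.
  by eexists; rewrite /= exprN1 ql_monomV scaleN1r.
elim: m => [|m [c IH]].
  have -> : (e : int) * 0%:Z = 0 by exact: mulr0.
  by exists 1; rewrite scale0r scale1r.
eexists; rewrite exprSr IH H0 -ql_scaleAl -ql_scaleAr ql_monomM !scalerA.
by rewrite -scalerDl intS mulrDr mulr1 [(e : int) + _]addrC.
Qed.

Lemma ql_YX_supp m a : qlc ((ql_Y k ^ e) ^+ m) a != 0 ->
  a = ((e : int) * m%:Z) *: delta_mx 0 k.
Proof.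
have [c ->] := ql_YX_monom m; rewrite /= /monom.
by case: (eqVneq a (_ *: _)) => // _; rewrite mulr0 eqxx.
Qed.

Lemma ydeg_YX m : deg (((e : int) * m%:Z) *: delta_mx 0 k) = m%:Z.
Proof. by rewrite /ydeg !mxE !eqxx mulr1 mulrA; case: e; rewrite mul1r. Qed.

Lemma ql_at_Y_supp (f : fps K) : laurent_supp deg
  (fun a => \sum_(m \in [set: nat]) fpsc f m * qlc ((ql_Y k ^ e) ^+ m) a).
Proof.
have nz a : \sum_(m \in [set: nat]) fpsc f m * qlc ((ql_Y k ^ e) ^+ m) a != 0 ->
    exists m : nat, a = ((e : int) * m%:Z) *: delta_mx 0 k.
  move=> H; apply: contrapT => H'; move/eqP: H; apply.
  apply: fsbig1 => m _; apply/eqP; rewrite mulf_eq0; apply/orP; right.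
  by apply/negPn/negP => /ql_YX_supp am; apply: H'; exists m.
split; first by exists 0 => a /nz[m ->]; rewrite [X in _ <= X]ydeg_YX.
move=> N; apply: sub_finite_set (finite_set1 (((e : int) * N) *: delta_mx 0 k)).
by move=> a /= [aN /nz[m am]]; move: aN; rewrite am [X in X = _]ydeg_YX => <-.
Qed.

(* f(Y_k^e) = sum_m f_m (Y_k^e)^m, computed coefficientwise (each monomial
   occurs in at most one of the terms) *)
Definition ql_at_Y (f : fps K) : A := QLaurent L (ql_at_Y_supp f).

End Ring.
End QuantumLaurent.

Arguments ql_Y {F n L k e} i.
Arguments ql_at_Y {F n L k e} f.

(* Ad(x)^m (y) *)
Definition Ad (R : unitRingType) (x : R) (m : int) (y : R) : R :=
  x ^ m * y * x ^ (- m).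

(** * Quantum Y-seeds *)

Definition skew_symmetrizable (n : nat) (B : 'M[int]_n) : Prop :=
  exists2 s : 'I_n -> nat, (forall i, 0 < s i)%N
    & forall i j, (s i)%:Z * B i j = - ((s j)%:Z * B j i).

(* skew-symmetric for a seed; gives Y_i Y_j = q^(2 r_j d_j b_ji) Y_j Y_i, see
   ql_Y_comm *)
Definition seed_form (n : nat) (B : 'M[int]_n) (d r : 'I_n -> nat) : 'M[int]_n :=
  \matrix_(i, j) ((r j * d j)%:Z * B j i).

Lemma lform_delta n (L : 'M[int]_n) i j :
  lform L (delta_mx 0 i) (delta_mx 0 j) = L i j.
Proof.
rewrite /lform (bigD1 i) //= [X in _ + X]big1 ?addr0; last first.
  by move=> i' /negbTE ne; rewrite big1 // => j' _; rewrite !mxE ne !mul0r.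
rewrite (bigD1 j) //= big1 ?addr0; first by rewrite !mxE !eqxx mul1r mulr1.
by move=> j' /negbTE ne; rewrite !mxE ne mulr0.
Qed.

Lemma ql_Y_comm (F : fieldType) n (B : 'M[int]_n) (d r : 'I_n -> nat) k e :
  (forall i j, (r i * d i)%:Z * B i j = - ((r j * d j)%:Z * B j i)) ->
  forall i j, let Y := @ql_Y F n (seed_form B d r) k e in
  Y i * Y j = qvar F ^ (2 * (r j * d j)%:Z * B j i) *: (Y j * Y i).
Proof.
move=> skew i j Y; rewrite /Y !ql_monomM scalerA [_ + delta_mx 0 i]addrC.
congr (_ *: _); rewrite /ytwist -expfzDr ?qvar_neq0 // !lform_delta !mxE.
by rewrite (skew i j) -mulrA mulrDl mul1r addrK.
Qed.

(* Main.v *)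
Require Import Defs.
From HB Require Import structures.
From mathcomp Require Import all_boot all_order all_algebra.
From mathcomp Require Import all_classical ring.
Set Implicit Arguments.
Unset Strict Implicit.
Import GRing.Theory Num.Theory.
Local Open Scope ring_scope.

(** Write [p(x) = sum_s z_(k,s) x^s], [t = q_k], [b = b_ki], [U = Y_k^e] and
    [Psi(x) = prod_(m >= 0) p(t^(2m+1) x)^-1].  Cancelling the factor [m = 0] of
    the product gives the q-difference equation [p(t x) Psi(x) = Psi(t^2 x)].
    Iterating it [N] times, forwards or backwards, expresses
    [Psi(t^(2N) x) / Psi(x)] and [Psi(x) / Psi(t^(-2N) x)] as the products of the
    [p(t^(2m-1) x)], resp. of the [p(t^(-(2m-1)) x)], for [1 <= m <= N]
    ([fps_qdiff_shift]).

    The relation [U Y_i = t^(-2eb) Y_i U] ([ql_Yk_Yi_comm]) turns moving [Y_i]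
    to the left of a series in [U] into the dilation [x |-> t^(-2eb) x] of that
    series ([ql_at_Y_comm_monom]).  Hence
    [Psi(U)^e Y_i Psi(U)^(-e) = Y_i (Psi(t^(-2eb) U) / Psi(U))^e], and the
    right-hand factor is the asserted finite product with [N = |b|], dilating
    forwards or backwards according to the sign [- e sgn b].  The computations
    with quotients of [Psi] take place in the commutative ring of power series,
    and are carried to Laurent series by the substitution [x |-> U], which is a
    ring morphism ([ql_at_Y_is_monoid_morphism]).

    It remains to see that the infinite product, a coefficientwise q-adic limit,
    exists in F(q).  The difference equation determines a series from its
    constant term 1, by a recursion dividing by [1 - t^(2j)] in degree [j]
    ([fps_qdiff_sol]).  Its coefficients are therefore rational functions regular
    at [q = 0], and this makes the partial products converge to it
    ([fps_qdiff_cvg]). *)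

(** * Formal power series: course-of-values recursion, units, dilations *)

(** Both the inverse of a power series and the solution of a q-difference
    equation are defined by giving each coefficient in terms of all the previous
    ones; the list passed to [G] has length [j], which is how [G] knows [j]. *)
Lemma course_of_values (T : Type) (G : seq T -> T) :
  exists u : nat -> T, forall j, u j = G (mkseq u j).
Proof.
pose s j := iter j (fun l => rcons l (G l)) [::].
exists (fun j => G (s j)) => j; congr G.
by elim: j => // j IHj; rewrite mkseqS -IHj.
Qed.

Lemma fpscM (R : comNzRingType) (f g : fps R) j :
  fpsc (f * g) j = \sum_(i < j.+1) fpsc f i * fpsc g (j - i).
Proof. by []. Qed.

Lemma fpsc1 (R : comNzRingType) j : fpsc (1 : fps R) j = (j == 0%N)%:R.
Proof. exact: coef1. Qed.

Lemma fpscB (R : comNzRingType) (f g : fps R) j :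
  fpsc (f - g) j = fpsc f j - fpsc g j.
Proof. by []. Qed.

(** The coefficient of degree [j] in [g * f = 1] is an equation for [g_j] whose
    leading factor is the constant term of [f]. *)
Lemma fps_unitr (R : comUnitRingType) (f : fps R) :
  fpsc f 0 \is a GRing.unit -> f \is a GRing.unit.
Proof.
move=> f0; have [g gE] := course_of_values (fun l =>
  ((size l == 0%N)%:R - \sum_(i < size l) nth 0 l i * fpsc f (size l - i))
    / fpsc f 0).
apply/asboolP; exists (FPS g); apply: fpsP => j.
rewrite fpscM fpsc1 big_ord_recr /= subnn [g j]gE size_mkseq divrK //.
rewrite addrCA [X in _ + X](_ : _ = 0) ?addr0 //.
apply/eqP; rewrite subr_eq0; apply/eqP/eq_bigr => i _.
by rewrite nth_mkseq.
Qed.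

Definition fps_dilate (R : comNzRingType) (c : R) (f : fps R) : fps R :=
  FPS (fun j => c ^+ j * fpsc f j).

Fact fps_dilate_is_zmod_morphism (R : comNzRingType) (c : R) :
  zmod_morphism (fps_dilate c).
Proof. by move=> f g; apply: fpsP => j; rewrite /= mulrBr. Qed.

Fact fps_dilate_is_monoid_morphism (R : comNzRingType) (c : R) :
  monoid_morphism (fps_dilate c).
Proof.
split=> [|f g]; apply: fpsP => j /=.
  by rewrite coef1; case: j => [|j]; rewrite ?mulr1 // mulr0.
rewrite mulr_sumr; apply: eq_bigr => i _ /=.
by rewrite mulrACA -exprD subnKC // -ltnS.
Qed.

HB.instance Definition _ (R : comNzRingType) (c : R) :=
  GRing.isZmodMorphism.Build (fps R) (fps R) (fps_dilate c)
    (@fps_dilate_is_zmod_morphism R c).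
HB.instance Definition _ (R : comNzRingType) (c : R) :=
  GRing.isMonoidMorphism.Build (fps R) (fps R) (fps_dilate c)
    (@fps_dilate_is_monoid_morphism R c).

Lemma fps_dilateA (R : comNzRingType) (a b : R) f :
  fps_dilate a (fps_dilate b f) = fps_dilate (a * b) f.
Proof. by apply: fpsP => j /=; rewrite mulrA exprMn. Qed.

Lemma fps_dilate1 (R : comNzRingType) (f : fps R) : fps_dilate 1 f = f.
Proof. by apply: fpsP => j /=; rewrite expr1n mul1r. Qed.

Lemma fps_dilate_poly (R : comNzRingType) (c : R) N (E : nat -> R) :
  fps_dilate c (fps_of_poly (\poly_(s < N) E s)) =
  fps_of_poly (\poly_(s < N) (E s * c ^+ s)).
Proof.
by apply: fpsP => j /=; rewrite !coef_poly; case: ifP; rewrite ?mulr0 // mulrC.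
Qed.

(** * The local ring of rational functions regular at q = 0 *)

Section QAdic.
Variable F : fieldType.
Implicit Types x y : ratfun F.

Lemma tofrac_horner0_neq0 (g : {poly F}) : g.[0] != 0 -> g%:F != 0.
Proof. by rewrite tofrac_eq0; apply: contra_neq => ->; rewrite horner0. Qed.

Lemma qadic_smallM N N' x y :
  qadic_small N x -> qadic_small N' y -> qadic_small (N + N') (x * y).
Proof.
move=> [p [g [g0 ->]]] [p' [g' [g'0 ->]]].
exists (p * p'), (g * g'); split; first by rewrite hornerM mulf_neq0.
by rewrite mulf_div -!tofracM exprD mulrACA.
Qed.

Lemma qadic_small_le N N' x : (N <= N')%N -> qadic_small N' x -> qadic_small N x.
Proof.
move=> /subnKC <- [p [g [g0 ->]]]; exists ('X^(N' - N) * p), g; split=> //.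
by rewrite exprD mulrA.
Qed.

Lemma qadic_small_poly N (p : {poly F}) : qadic_small N ('X^N * p)%:F.
Proof. by exists p, 1; rewrite hornerC oner_neq0 tofrac1 divr1. Qed.

Lemma qadic_small_zero N : qadic_small N (0 : ratfun F).
Proof. by rewrite -tofrac0 -(mulr0 'X^N); apply: qadic_small_poly. Qed.

Lemma qadic_small_one : qadic_small 0 (1 : ratfun F).
Proof. by rewrite -tofrac1 -(mul1r (1 : {poly F})); apply: qadic_small_poly. Qed.

Lemma qadic_small_const c : qadic_small 0 (ratconst c : ratfun F).
Proof. by rewrite /ratconst -[_%:P]mul1r; apply: qadic_small_poly. Qed.

Lemma qadic_smallN N x : qadic_small N x -> qadic_small N (- x).
Proof.
by move=> xs; rewrite -sub0r; apply: qadic_smallB => //; apply: qadic_small_zero.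
Qed.

Lemma qadic_small_sum N (I : Type) (s : seq I) (E : I -> ratfun F) :
  (forall i, qadic_small N (E i)) -> qadic_small N (\sum_(i <- s) E i).
Proof.
move=> Es; apply: big_ind => [|x y xs ys|//]; first exact: qadic_small_zero.
by rewrite -[y]opprK; apply: qadic_smallB => //; apply: qadic_smallN.
Qed.

Lemma qadic_smallX m x : qadic_small 1 x -> qadic_small m (x ^+ m).
Proof.
move=> xs; elim: m => [|m IHm]; first by rewrite expr0; exact: qadic_small_one.
by rewrite exprS -add1n; apply: qadic_smallM.
Qed.

(** The inverse of [1 - x] is regular at [q = 0] because [1 - x] takes the value
    1 there. *)
Lemma qadic_small_geom x : qadic_small 1 x ->
  1 - x != 0 /\ qadic_small 0 (1 - x)^-1.
Proof.
move=> [p [g [g0 ->]]]; have gn := tofrac_horner0_neq0 g0.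
have hn : (g - 'X^1 * p).[0] != 0.
  by rewrite hornerD hornerN hornerM hornerX mul0r subr0.
have -> : 1 - ('X^1 * p)%:F / g%:F = (g - 'X^1 * p)%:F / g%:F.
  by rewrite tofracB mulrBl divff.
split; first by rewrite mulf_neq0 ?invr_eq0 ?tofrac_horner0_neq0.
by exists g, (g - 'X^1 * p); rewrite invf_div mul1r.
Qed.

Definition fps_regular (f : fps (ratfun F)) : Prop :=
  forall j, qadic_small 0 (fpsc f j).

Lemma fps_regularM f g : fps_regular f -> fps_regular g -> fps_regular (f * g).
Proof.
move=> fr gr j; rewrite fpscM; apply: qadic_small_sum => i.
by rewrite -[0%N]addn0; apply: qadic_smallM.
Qed.

Lemma fps_regular_dilate c f :
  qadic_small 0 c -> fps_regular f -> fps_regular (fps_dilate c f).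
Proof.
move=> cr fr j /=; rewrite -[0%N]addn0; apply: qadic_smallM => //.
elim: j => [|j IHj]; first exact: qadic_small_one.
by rewrite exprS -[0%N]addn0; apply: qadic_smallM.
Qed.

(** Since the constant term is 1, the recursion for the coefficients of the
    inverse uses no division. *)
Lemma fps_regularV f : fpsc f 0 = 1 -> fps_regular f -> fps_regular f^-1.
Proof.
move=> f0 fr; have fu : f \is a GRing.unit by rewrite fps_unitr ?f0 ?unitr1.
elim/ltn_ind => j IHj; have /(congr1 (fun g => fpsc g j)) := mulVr fu.
rewrite fpscM fpsc1 big_ord_recr /= subnn f0 mulr1 => /eqP.
rewrite addrC eq_sym -subr_eq => /eqP <-; apply: qadic_smallB.
  by case: (j == 0%N); [exact: qadic_small_one | exact: qadic_small_zero].
apply: qadic_small_sum => i; rewrite -[0%N]addn0.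
by apply: qadic_smallM => //; apply: IHj.
Qed.

(** * The quantum dilogarithm and its difference equation *)

(** In degree [j] the equation reads
    [sum_(i < j) psi_i t^(j-i) p_(j-i) = (t^(2j) - 1) psi_j], and [1 - t^(2j)]
    is invertible in the local ring at [q = 0] for [j > 0]. *)
Lemma fps_qdiff_sol (p : fps (ratfun F)) t :
  fpsc p 0 = 1 -> fps_regular p -> qadic_small 1 t ->
  exists psi : fps (ratfun F), [/\ fpsc psi 0 = 1, fps_regular psi &
    fps_dilate t p * psi = fps_dilate (t ^+ 2) psi].
Proof.
move=> p0 pr ts.
have t2s j : qadic_small 1 ((t ^+ 2) ^+ j.+1).
  by rewrite -exprM; apply: qadic_small_le (qadic_smallX _ ts); rewrite muln_gt0.
have [psi psiE] := course_of_values (fun l =>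
  if l is [::] then 1 else
  - (1 - (t ^+ 2) ^+ size l)^-1 *
    \sum_(i < size l) nth 0 l i * (t ^+ (size l - i) * fpsc p (size l - i))).
have psiS j : psi j.+1 = - (1 - (t ^+ 2) ^+ j.+1)^-1 *
    \sum_(i < j.+1) psi i * (t ^+ (j.+1 - i) * fpsc p (j.+1 - i)).
  rewrite psiE; case El: (mkseq _ _) => [|x l].
    by have := size_mkseq psi j.+1; rewrite El.
  rewrite -{x l}El size_mkseq; congr (_ * _); apply: eq_bigr => i _.
  by rewrite nth_mkseq.
have psi0 : psi 0%N = 1 by rewrite psiE.
exists (FPS psi); split=> //.
- elim/ltn_ind => -[|j] IHj /=; first by rewrite psi0; exact: qadic_small_one.
  rewrite psiS -[0%N]addn0; apply: qadic_smallM.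
    by apply: qadic_smallN; have [] := qadic_small_geom (t2s j).
  apply: qadic_small_sum => i; rewrite -[0%N]addn0.
  apply: qadic_smallM; first exact: (IHj i).
  by apply: (@fps_regular_dilate t p) => //; apply: qadic_small_le ts.
apply: fpsP => -[|j]; rewrite mulrC fpscM big_ord_recr /= subnn p0.
  by rewrite big_ord0 add0r !mulr1 mul1r.
have [nz _] := qadic_small_geom (t2s j).
have -> : \sum_(i < j.+1) psi i * (t ^+ (j.+1 - i) * fpsc p (j.+1 - i)) =
    - (1 - (t ^+ 2) ^+ j.+1) * psi j.+1.
  by rewrite psiS mulrA mulrNN divff // mul1r.
by rewrite expr0 !mulr1; ring.
Qed.

(** The equation, solved for [psi(x) = p(t x)^-1 psi(t^2 x)], is substituted into
    itself [M] times. *)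
Lemma fps_qdiff_iter (p psi : fps (ratfun F)) t M : fpsc p 0 = 1 ->
  fps_dilate t p * psi = fps_dilate (t ^+ 2) psi ->
  psi = (\prod_(m < M) (fps_dilate (t ^+ (2 * m + 1)) p)^-1)
        * fps_dilate (t ^+ (2 * M)) psi.
Proof.
move=> p0 psiE; elim: M => [|M IHM]; first by rewrite big_ord0 mul1r fps_dilate1.
have pu : fps_dilate (t ^+ (2 * M + 1)) p \is a GRing.unit.
  by apply: fps_unitr; rewrite /= p0 mulr1 unitr1.
have -> : t ^+ (2 * M.+1) = t ^+ (2 * M) * t ^+ 2 by rewrite -exprD mulnS addnC.
rewrite big_ord_recr /= -fps_dilateA -psiE rmorphM /= fps_dilateA.
by rewrite -[t ^+ (2 * M) * t]exprSr -[(2 * M).+1]addn1 -mulrA mulKr.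
Qed.

(** The [M]-th partial product differs from [psi] by its product with
    [1 - psi(t^(2M) x)], whose coefficient of degree [j] is [0] for [j = 0] and
    divisible by [t^(2Mj)] otherwise. *)
Lemma fps_qdiff_cvg (p psi : fps (ratfun F)) t : fpsc p 0 = 1 ->
  fps_regular p -> qadic_small 1 t ->
  fpsc psi 0 = 1 -> fps_regular psi ->
  fps_dilate t p * psi = fps_dilate (t ^+ 2) psi ->
  forall j, qadic_cvg (fun M =>
    fpsc (\prod_(m < M) (fps_dilate (t ^+ (2 * m + 1)) p)^-1) j) (fpsc psi j).
Proof.
move=> p0 pr ts psi0 psir psiE j N; exists N => M NM.
set PM := \prod_(m < M) _.
have tr m : qadic_small 0 (t ^+ m).
  by apply: qadic_small_le (qadic_smallX m ts).
have PMr : fps_regular PM.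
  apply: big_ind => [i|f g|m _].
  - by rewrite fpsc1; case: eqP => _; [exact: qadic_small_one|exact: qadic_small_zero].
  - exact: fps_regularM.
  - by apply: fps_regularV; [rewrite /= p0 mulr1|apply: fps_regular_dilate].
rewrite [psi](fps_qdiff_iter M p0 psiE) -/PM -fpscB -[X in X - _]mulr1 -mulrBr.
rewrite fpscM; apply: qadic_small_sum => i; rewrite -[N]add0n.
apply: qadic_smallM => //; case: (j - i)%N => [|l].
  by rewrite fpscB /= psi0 coef1 mulr1 subrr; exact: qadic_small_zero.
rewrite fpscB fpsc1 sub0r; apply: qadic_smallN => /=; rewrite -[N]addn0.
apply: qadic_smallM => //; rewrite -exprM.
apply: qadic_small_le (qadic_smallX _ ts); apply: leq_trans NM _.
by rewrite -mulnA mulnCA leq_pmulr.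
Qed.

Definition dilog_poly d (w : nat -> F) : fps (ratfun F) :=
  fps_of_poly (\poly_(s < d.+1) ratconst (with_ends d w s)).

Lemma dilog_poly0 d w : fpsc (dilog_poly d w) 0 = 1.
Proof. by rewrite /= coef_poly /with_ends /= /ratconst tofrac1. Qed.

(** The coefficientwise limit defining the quantum dilogarithm is the solution
    of the difference equation given by [fps_qdiff_sol]. *)
Lemma qdilog_qdiff d w t (psi := @qdilog F d w t) : qadic_small 1 t ->
  fpsc psi 0 = 1 /\
  fps_dilate t (dilog_poly d w) * psi = fps_dilate (t ^+ 2) psi.
Proof.
move=> ts; have p0 := dilog_poly0 d w; set p := dilog_poly d w.
have pr : fps_regular p.
  move=> j; rewrite /= coef_poly; case: ifP => _; last exact: qadic_small_zero.
  exact: qadic_small_const.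
have [phi [phi0 phir phiE]] := fps_qdiff_sol p0 pr ts.
suff -> : psi = phi by [].
apply: fpsP => j; apply: qadic_limE.
rewrite [X in qadic_cvg X _](_ : _ = fun M =>
  fpsc (\prod_(m < M) (fps_dilate (t ^+ (2 * m + 1)) p)^-1) j).
  exact: fps_qdiff_cvg.
apply/funext => M; congr (fpsc _ j); apply: eq_bigr => m _.
rewrite /p /dilog_poly fps_dilate_poly; congr (fps_of_poly _)^-1.
by apply/polyP => s; rewrite !coef_poly mulnC exprM.
Qed.

End QAdic.

(** Induction on [N], with the equation read at [t^(2N) x] when [s = 1] and at
    [t^(-2N-2) x] when [s = -1].  The sign sits in the exponents so that one
    formula covers both directions of dilation. *)
Lemma fps_qdiff_shift (K : fieldType) (p psi : fps K) t (s : sign) N :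
  t != 0 -> fpsc p 0 = 1 ->
  fps_dilate t p * psi = fps_dilate (t ^+ 2) psi ->
  fps_dilate (t ^ ((s : int) * (2 * N%:Z))) psi =
  psi * (\prod_(1 <= m < N.+1)
    fps_dilate (t ^ ((s : int) * (2 * m%:Z - 1))) p) ^ (s : int).
Proof.
move=> t0 p0 psiE.
have pu c : fps_dilate c p \is a GRing.unit.
  by apply: fps_unitr; rewrite /= p0 mulr1 unitr1.
have stepE (c : K) : fps_dilate (c * t ^+ 2) psi =
    fps_dilate (c * t) p * fps_dilate c psi.
  by rewrite -(fps_dilateA c (t ^+ 2)) -psiE rmorphM /= fps_dilateA.
elim: N => [|N IHN].
  by rewrite big_geq // exp1rz !mulr0 expr0z fps_dilate1 mulr1.
rewrite big_nat_recr; last by [].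
set Q := \prod_(1 <= m < N.+1) _ in IHN *.
have Qu : Q \is a GRing.unit by apply: rpred_prod => m _; exact: pu.
clearbody Q; case: s IHN => /= IHN.
  have -> : t ^ (1 * (2 * N.+1%:Z)) = t ^ (1 * (2 * N%:Z)) * t ^+ 2.
    by rewrite (exprnP t 2) -expfzDr // intS; congr (_ ^ _); ring.
  rewrite stepE IHN !expr1z [LHS]mulrC [RHS]mulrA; congr (_ * fps_dilate _ p).
  by rewrite -[X in _ * X = _]expr1z -expfzDr // intS; congr (_ ^ _); ring.
have E1 : t ^ (- 1 * (2 * N%:Z)) = t ^ (- 1 * (2 * N.+1%:Z)) * t ^+ 2.
  by rewrite (exprnP t 2) -expfzDr // intS; congr (_ ^ _); ring.
have E2 : t ^ (- 1 * (2 * N.+1%:Z)) * t = t ^ (- 1 * (2 * N.+1%:Z - 1)).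
  by rewrite -[X in _ * X = _]expr1z -expfzDr // intS; congr (_ ^ _); ring.
move: IHN; rewrite E1 stepE E2 !exprN1 => IHN.
set D := fps_dilate _ p in IHN *; have Du : D \is a GRing.unit by exact: pu.
by apply: (mulrI Du); rewrite IHN invrM // [RHS]mulrCA mulVKr.
Qed.

(** * Substituting Y_k^e into a power series *)

Section AtY.
Variables (F : fieldType) (n : nat) (L : 'M[int]_n) (k : 'I_n) (e : sign).
Local Notation K := (ratfun F).
Local Notation A := (@qlaurent F n L k e).
Local Notation U := ((ql_Y k : A) ^ (e : int)).
Local Notation Mon := (@ql_monom F n L k e).
Local Notation u m := (((e : int) * m%:Z) *: delta_mx 0 k : 'rV[int]_n).

Lemma qlcB (x y : A) a : qlc (x - y) a = qlc x a - qlc y a.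
Proof. by []. Qed.

Lemma qlcM (x y : A) a :
  qlc (x * y) a = conv (@ytwist F n L) (qlc x) (qlc y) a.
Proof. by []. Qed.

Lemma ql_uD i j : u i + u j = u (i + j)%N.
Proof. by rewrite -scalerDl -mulrDr -PoszD. Qed.

Lemma ql_u_inj : injective (fun m => u m).
Proof.
by move=> i j /(congr1 (ydeg k e)); rewrite [LHS]ydeg_YX [RHS]ydeg_YX => -[].
Qed.

Lemma qlc_at_Y (f : fps K) m :
  qlc (ql_at_Y f : A) (u m) = fpsc f m * qlc (U ^+ m) (u m).
Proof.
rewrite /= -(fsbig_widen [set m]%classic) ?fsbig_set1 // => j [_ jm] /=.
apply/eqP; rewrite mulf_eq0; apply/orP; right; apply/negPn/negP => /ql_YX_supp.
by move=> /ql_u_inj mj; apply: jm.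
Qed.

(** Series with this support are equal as soon as their coefficients at the
    exponents [u m] agree, see [on_YP]. *)
Definition on_Y (x : A) : Prop := forall a, qlc x a != 0 -> exists m, a = u m.

Lemma on_Y_at_Y (f : fps K) : on_Y (ql_at_Y f).
Proof.
move=> a; apply: contra_neqP => aNu; rewrite /= fsbig1 // => m _.
apply/eqP; rewrite mulf_eq0; apply/orP; right; apply/negPn/negP => /ql_YX_supp.
by move=> am; apply: aNu; exists m.
Qed.

Lemma on_YP (x y : A) : on_Y x -> on_Y y ->
  (forall m, qlc x (u m) = qlc y (u m)) -> x = y.
Proof.
move=> xY yY xy; apply: qlP => a.
have [[m ->]//|aNu] := pselect (exists m, a = u m).
have off (w : A) : on_Y w -> qlc w a = 0.
  by move=> wY; apply: contra_notP aNu => /eqP /wY.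
by rewrite !off.
Qed.

Fact ql_at_Y_is_zmod_morphism : zmod_morphism (ql_at_Y : fps K -> A).
Proof.
move=> f g; apply: on_YP => [|a|m]; first exact: on_Y_at_Y.
  apply: contra_neqP => aNu; have off h : qlc (ql_at_Y h : A) a = 0.
    by apply: contra_notP aNu => /eqP /on_Y_at_Y.
  by rewrite qlcB !off subr0.
by rewrite qlcB !qlc_at_Y fpscB mulrBl.
Qed.

(** The monomials [Y^(u i)] and [Y^(u j)] multiply to a twisted [Y^(u (i + j))],
    but the coefficients of the powers of [U] absorb exactly this twist, since
    [U^i U^j = U^(i+j)]; so twisted convolution restricts to the Cauchy product. *)
Fact ql_at_Y_is_monoid_morphism : monoid_morphism (ql_at_Y : fps K -> A).
Proof.
split.
  apply: on_YP => [|a|m]; first exact: on_Y_at_Y.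
    by rewrite -(expr0 U) => /ql_YX_supp; exists 0%N.
  rewrite qlc_at_Y fpsc1; case: m => [|m]; first by rewrite mul1r expr0.
  rewrite mul0r; apply/esym/eqP/negPn/negP; rewrite -(expr0 U).
  by move=> /ql_YX_supp /ql_u_inj.
move=> f g; apply: on_YP => [|a|m]; first exact: on_Y_at_Y.
  move=> /= /conv_neq0 [b /on_Y_at_Y [i ->]] /on_Y_at_Y [j aj].
  by exists (i + j)%N; rewrite -ql_uD -aj addrC subrK.
rewrite qlc_at_Y qlcM.
rewrite (@convE _ _ _ _ _ _ [set u i | i in `I_m.+1]%classic); last first.
  move=> b /on_Y_at_Y [i ->] /on_Y_at_Y [j aj]; exists i => //=.
  have /ql_u_inj -> : u m = u (i + j)%N by rewrite -ql_uD -aj addrC subrK.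
  by rewrite ltnS leq_addr.
rewrite (reindex_fsbig (fun i => u i) `I_m.+1); last first.
  split=> [i im|i j _ _ /ql_u_inj //|b //]; first by exists i.
rewrite -fsbig_ord fpscM mulr_suml; apply: eq_bigr => i _.
have im : (i <= m)%N by rewrite -ltnS.
have umi : u m - u i = u (m - i)%N.
  by apply/eqP; rewrite subr_eq ql_uD subnK.
have UE j : U ^+ j = qlc (U ^+ j) (u j) *: Mon (u j).
  have [c cE] := ql_YX_monom F L k e j; rewrite [LHS]cE [in RHS]cE /=.
  by rewrite /monom eqxx mulr1.
have UM : U ^+ m = U ^+ i * U ^+ (m - i) by rewrite -exprD subnKC.
rewrite umi !qlc_at_Y UM (UE i) (UE (m - i)%N).
rewrite -scalerAl -scalerAr ql_monomM /= ql_uD subnKC // /monom !eqxx !mulr1.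
by ring.
Qed.

HB.instance Definition _ := GRing.isZmodMorphism.Build (fps K) A
  (ql_at_Y : fps K -> A) ql_at_Y_is_zmod_morphism.
HB.instance Definition _ := GRing.isMonoidMorphism.Build (fps K) A
  (ql_at_Y : fps K -> A) ql_at_Y_is_monoid_morphism.

Lemma ql_at_Y_poly N (E : nat -> K) :
  ql_at_Y (fps_of_poly (\poly_(s < N) E s)) = \sum_(s < N) E s *: U ^+ s.
Proof.
apply: qlP => a; rewrite (big_morph (fun x : A => qlc x a) (id1 := 0) (op1 := +%R)) //=.
rewrite -(fsbig_widen `I_N) // => [|s [_ sN] /=]; last first.
  by rewrite coef_poly; case: ifP sN => [/[swap] []//|_ _]; rewrite mul0r.
rewrite -fsbig_ord; apply: eq_bigr => s _.
by rewrite coef_poly ltn_ord.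
Qed.

(** Moving a monomial past [U^m] costs [c^m], that is, a dilation by [c].  The
    identity can be checked coefficientwise, term by term in the power series,
    because multiplication by a monomial merely shifts and scales coefficients. *)
Lemma ql_at_Y_comm_monom (c : K) b (f : fps K) :
  U * Mon b = c *: (Mon b * U) ->
  ql_at_Y f * Mon b = Mon b * ql_at_Y (fps_dilate c f).
Proof.
move=> Ub; have UXb m :
    U ^+ m * Mon b = c ^+ m *: (Mon b * U ^+ m).
  elim: m => [|m IHm]; first by rewrite !expr0 mul1r mulr1 scale1r.
  rewrite exprSr -mulrA Ub -scalerAr [X in _ *: X]mulrA IHm -scalerAl.
  by rewrite scalerA -exprS -mulrA.
apply: qlP => a; rewrite /= conv_monomr conv_monoml !mulr_fsuml.
apply: eq_fsbigr => m _; rewrite -!mulrA -conv_monomr.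
have /= -> := congr1 (fun x : A => qlc x a) (UXb m).
by rewrite conv_monoml mulrCA !mulrA.
Qed.

End AtY.

Lemma unitr_intertwine_sign (R : unitRingType) (x x' y : R) (s : sign) :
  x \is a GRing.unit -> x' \is a GRing.unit ->
  x * y = y * x' -> x ^ (s : int) * y = y * x' ^ (s : int).
Proof.
move=> xu x'u xy; case: s => /=; first by rewrite !expr1z.
by rewrite !exprN1; apply: (mulrI xu); rewrite mulVKr // mulrA xy mulrK.
Qed.

(** * Conjugating Y_i by the quantum dilogarithm *)

Lemma qvarX_small (F : fieldType) N : (0 < N)%N -> qadic_small 1 (qvar F ^+ N).
Proof.
move=> N0; apply: (@qadic_small_le _ _ N) => //.
by rewrite /qvar -tofracXn -[_ ^+ N]mulr1; apply: qadic_small_poly.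
Qed.

Lemma ql_Yk_Yi_comm (F : fieldType) n (B : 'M[int]_n) (d r : 'I_n -> nat) i k e :
  (forall i j, (r i * d i)%:Z * B i j = - ((r j * d j)%:Z * B j i)) ->
  let Y (j : 'I_n) : qlaurent F (seed_form B d r) k e := ql_Y j in
  let q_k : ratfun F := qvar F ^+ (r k * d k) in
  Y k ^ (e : int) * Y i =
  q_k ^ (- ((e : int) * (2 * B k i))) *: (Y i * Y k ^ (e : int)).
Proof.
move=> skew Y q_k; set c := q_k ^ (- (2 * B k i)).
have qk0 : q_k != 0 by rewrite expf_neq0 ?qvar_neq0.
have YkE : Y k * Y i = c *: (Y i * Y k).
  rewrite /Y (@ql_Y_comm F n B d r k e skew); congr (_ *: _).
  rewrite /c /q_k exprnP exprz_exp; congr (_ ^ _).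
  by rewrite -mulrA -[_ * B i k]opprK -skew; ring.
have Yu : Y k \is a GRing.unit by exact: ql_monom_unit.
case: e @Y YkE Yu => Y YkE Yu; first by rewrite !expr1z mul1r.
have -> : q_k ^ (- ((Minus : int) * (2 * B k i))) = c^-1.
  by rewrite /c invr_expz; congr (_ ^ _) => /=; ring.
rewrite !exprN1; apply: (mulrI Yu); rewrite mulVKr // -scalerAr mulrA YkE.
by rewrite -scalerAl mulrK // scalerA mulVf ?expfz_neq0 // scale1r.
Qed.

Lemma sgz_sign (b : int) : b != 0 -> exists s : sign, sgz b = s.
Proof. by case: sgzP => // _ _; [exists Plus | exists Minus]. Qed.

Unset Implicit Arguments.

Theorem lemma3p3 (F : fieldType) (n : nat) (B : 'M[int]_n)
    (d r : 'I_n -> nat) (z : 'I_n -> nat -> F)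
    (B_skew : skew_symmetrizable B)
    (d_gt0 : forall i, (0 < d i)%N)
    (r_gt0 : forall i, (0 < r i)%N)
    (rdB_skew : forall i j,
       (r i * d i)%:Z * B i j = - ((r j * d j)%:Z * B j i))
    (z_recip : forall i s, (0 < s < d i)%N -> z i s = z i (d i - s)%N)
    (i k : 'I_n) (e : sign) :
  let q_k : ratfun F := qvar F ^+ (r k * d k) in
  let Y (j : 'I_n) : qlaurent F (seed_form B d r) k e := ql_Y j in
  Ad (ql_at_Y (qdilog (d k) (z k) q_k)) e (Y i) =
  Y i * \prod_(1 <= m < (absz (B k i)).+1)
    (\sum_(0 <= s < (d k).+1)
       (ratconst (with_ends (d k) (z k) s)
        * q_k ^ (- ((e : int) * sgz (B k i) * (2 * m%:Z - 1) * s%:Z)))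
       *: Y k ^ ((e : int) * s%:Z)) ^ (- sgz (B k i)).
Proof.
move=> q_k Y; set b := B k i; set psi := qdilog _ _ _.
pose p := dilog_poly (d k) (z k).
have qk0 : q_k != 0 by rewrite expf_neq0 ?qvar_neq0.
have rd_gt0 : (0 < r k * d k)%N by rewrite muln_gt0 r_gt0 d_gt0.
have [psi0 psiE] := qdilog_qdiff (d k) (z k) (qvarX_small F rd_gt0).
rewrite -/q_k -/psi -/p in psi0 psiE.
have dil_unit (a : ratfun F) (f : fps (ratfun F)) : fpsc f 0 = 1 -> fps_dilate a f \is a GRing.unit.
  by move=> f0; apply: fps_unitr; rewrite /= f0 mulr1 unitr1.
have psiu : psi \is a GRing.unit by apply: fps_unitr; rewrite psi0 unitr1.
have pu (a : ratfun F) : fps_dilate a p \is a GRing.unit.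
  by apply: dil_unit; exact: dilog_poly0.
pose E f : qlaurent F (seed_form B d r) k e := ql_at_Y f.
pose c := q_k ^ (- ((e : int) * (2 * b))).
have EpsiY : E psi * Y i = Y i * E (fps_dilate c psi).
  by apply: ql_at_Y_comm_monom; exact: ql_Yk_Yi_comm.
have Eu f : f \is a GRing.unit -> E f \is a GRing.unit by apply: rmorph_unit.
have EX f m : f \is a GRing.unit -> E f ^ m = E (f ^ m).
  by move=> fu; rewrite /E rmorphXz.
have factorE a : E (fps_dilate (q_k ^ a) p) =
    \sum_(0 <= s < (d k).+1) (ratconst (with_ends (d k) (z k) s)
        * q_k ^ (a * s%:Z)) *: Y k ^ ((e : int) * s%:Z).
  rewrite /E /p /dilog_poly fps_dilate_poly ql_at_Y_poly big_mkord.
  by apply: eq_bigr => s _; rewrite !exprnP !exprz_exp.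
rewrite /Ad -/(E psi) (unitr_intertwine_sign e (Eu _ psiu) (Eu _ (dil_unit c psi psi0)) EpsiY).
rewrite -mulrA; congr (Y i * _).
(* the two sides are compared as commutative power series *)
transitivity (E (\prod_(1 <= m < `|b|.+1)
    fps_dilate (q_k ^ (- ((e : int) * sgz b * (2 * m%:Z - 1)))) p ^ (- sgz b))).
  rewrite !EX ?dil_unit // -[LHS]rmorphM; congr ql_at_Y.
  have [b0|b_neq0] := eqVneq b 0.
    rewrite /c b0 !mulr0 oppr0 expr0z fps_dilate1 big_geq //.
    by rewrite -exprzDr // subrr expr0z.
  have [s sE] := sgz_sign b_neq0; rewrite sE.
  (* s' is the direction of the dilation by t^(-2eb) *)
  have [s' s'E] : exists s' : sign, (s' : int) = - ((e : int) * s).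
    by case: (e); case: (s); (by exists Plus) || by exists Minus.
  have -> : c = q_k ^ ((s' : int) * (2 * `|b|%:Z)).
    rewrite /c s'E; congr (_ ^ _); rewrite {1}(intEsg b) sE.
    ring.
  rewrite (fps_qdiff_shift _ _ qk0 (dilog_poly0 _ _) psiE) -/p.
  set Q := \prod_(_ <= _ < _) _.
  have Qu : Q \is a GRing.unit by apply: rpred_prod => m _; exact: pu.
  have -> : \prod_(1 <= m < `|b|.+1)
      fps_dilate (q_k ^ (- ((e : int) * s * (2 * m%:Z - 1)))) p ^ (- (s : int)) =
      Q ^ (- (s : int)).
    under eq_bigr => m _ do rewrite -mulNr -s'E.
    case: (s) => /=.
      rewrite exprN1 -prodrV => [|m _]; last exact: pu.
      by apply: eq_bigr => m _; rewrite exprN1.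
    by rewrite opprK expr1z; apply: eq_bigr => m _; rewrite expr1z.
  have Qsu : Q ^ (s' : int) \is a GRing.unit by exact: unitrXz.
  rewrite (exprMz_comm _ psiu Qsu (mulrC _ _)).
  rewrite mulrAC -exprzDr // subrr expr0z mul1r exprz_exp s'E; congr (Q ^ _).
  by case: (e); case: (s).
rewrite [LHS]rmorph_prod; apply: eq_bigr => m _.
set a := - (_ * _); transitivity (E (fps_dilate (q_k ^ a) p) ^ (- sgz b)).
  by apply: esym; exact: (EX (fps_dilate (q_k ^ a) p) (- sgz b) (pu _)).
rewrite factorE {}/a.
under eq_bigr => s _ do rewrite mulNr.
by [].
Qed.
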